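(* Let $Q:\mathcal{S}\times\mathcal{A}\to\mathbb{R}$ be a twice continuously differentiable function, and let $a^*(s)=\arg\max_{a}Q(s,a)$ be the induced greedy policy, where $a^*(s)$ is a strict local maximum of $Q(s,\cdot)$ and an interior point of $\mathcal{A}$. Suppose the mixed partial derivative is bounded by $\|\nabla^2_{sa}Q(s,a^*(s))\|_2\le M$ and the action Hessian satisfies the strict concavity condition $\lambda_{\max}\left(\nabla^2_{aa}Q(s,a^*(s))\right)\le-\mu<0$. Then the induced greedy policy is Lipschitz continuous with a constant $L$ satisfying $$\|a^*(s)-a^*(s')\|_2\le L\,\|s-s'\|_2,\quad\text{where } L\le\frac{M}{\mu},$$ for any pair of states $s,s'$.
   Context: $\mathcal{S}$ and $\mathcal{A}$ are the continuous state and action spaces of a Markov decision process (state vectors $s$ of dimension $k$, action vectors $a$ of dimension $d$), and $Q$ is a (parameterized) action-value function, the critic. $M$ and $\mu>0$ are constants, the two bounds being understood to hold at the states $s$ under consideration. $\|\cdot\|_2$ denotes the spectral norm for matrices and the Euclidean norm for vectors; $\lambda_{\max}(\cdot)$ denotes the maximum eigenvalue. $\nabla^2_{aa}Q(s,a)\in\mathbb{R}^{d\times d}$ is the Hessian of $Q$ in the action variable, with entries $\partial^2 Q/\partial a_i\partial a_j$. $\nabla^2_{sa}Q(s,a)\in\mathbb{R}^{d\times k}$ is the mixed state-action Hessian, i.e. the Jacobian with respect to $s$ of the action gradient $\nabla_a Q(s,a)$, with entries $\partial^2 Q/\partial a_i\partial s_j$.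
   Formalization: The state space is assumed convex and the action space closed (the claim fails without these), the argmax is read as the unique global maximizer over the action space, and Q is taken twice continuously differentiable on an open neighbourhood of the product of the two spaces. *)

(* Defs.v *)
From HB Require Import structures.
From mathcomp Require Import all_boot all_order all_algebra.
From mathcomp Require Import all_classical all_reals all_analysis.

Set Implicit Arguments.
Unset Strict Implicit.
Unset Printing Implicit Defensive.

Import Order.TTheory GRing.Theory Num.Theory.
Import numFieldNormedType.Exports.

Local Open Scope classical_set_scope.
Local Open Scope ring_scope.

(* The library norm on matrices is the entrywise maximum, so the Euclidean     *)
(* norm is introduced separately; both induce the same topology.               *)
Definition enorm (R : realType) (n : nat) (x : 'cV[R]_n) : R :=
  Num.sqrt (\sum_(i < n) x i 0 ^+ 2).

(* Operator norm for the Euclidean norms, i.e. the spectral norm.              *)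
Definition spectral_norm (R : realType) (m n : nat) (A : 'M[R]_(m, n)) : R :=
  sup [set enorm (A *m x) | x in [set x : 'cV[R]_n | enorm x <= 1]].

(* For symmetric A of positive size the set is finite and nonempty, so that    *)
(* sup is a maximum; for size 0 the value is the junk value sup set0 = 0.      *)
Definition lambda_max (R : realType) (n : nat) (A : 'M[R]_n) : R :=
  sup [set l : R | eigenvalue A l].

(* In finite dimension, continuity of the differential is the same as          *)
(* continuity of all the directional derivatives.                              *)
Definition C1_on (R : realType) (V : normedModType R) (U : set V) (f : V -> R)
    : Prop :=
  forall x, U x ->
    differentiable f x /\ forall v, {for x, continuous ('D_v f)}.

Definition C2_on (R : realType) (V : normedModType R) (U : set V) (f : V -> R)
    : Prop :=
  C1_on U f /\ forall v, C1_on U ('D_v f).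

Definition dir_s (R : realType) (k d : nat) (j : 'I_k) : 'cV[R]_k * 'cV[R]_d :=
  (delta_mx j 0, 0).

Definition dir_a (R : realType) (k d : nat) (i : 'I_d) : 'cV[R]_k * 'cV[R]_d :=
  (0, delta_mx i 0).

Definition hess_aa (R : realType) (k d : nat) (Q : 'cV[R]_k * 'cV[R]_d -> R)
    (s : 'cV[R]_k) (a : 'cV[R]_d) : 'M[R]_d :=
  \matrix_(i < d, j < d) 'D_(dir_a R k j) ('D_(dir_a R k i) Q) (s, a).

(* Jacobian in s of the action gradient: rows are action coordinates.          *)
Definition hess_sa (R : realType) (k d : nat) (Q : 'cV[R]_k * 'cV[R]_d -> R)
    (s : 'cV[R]_k) (a : 'cV[R]_d) : 'M[R]_(d, k) :=
  \matrix_(i < d, j < k) 'D_(dir_s R d j) ('D_(dir_a R k i) Q) (s, a).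

Definition argmax (R : realType) (T : Type) (A : set T) (f : T -> R) : set T :=
  [set a | A a /\ forall b, A b -> f b <= f a].

Definition strict_local_max (R : realType) (T : topologicalType) (f : T -> R)
    (a : T) : Prop :=
  \forall b \near a^', f b < f a.

Definition lipschitz2_on (R : realType) (k d : nat) (L : R) (S : set 'cV[R]_k)
    (f : 'cV[R]_k -> 'cV[R]_d) : Prop :=
  forall s s', S s -> S s' -> enorm (f s - f s') <= L * enorm (s - s').

(* Main.v *)
(* Put a = astar s. The action gradient vanishes at (s, a) and at (s', astar s'), so
   its first-order expansion at (s, a), paired with x = astar s' - a, gives
   mu |x|^2 <= M |s' - s| |x| + o(|s' - s| + |x|) |x|. Hence astar is Lipschitz at s
   with a constant close to M / mu along those s' for which astar s' stays close to a.
   As the maximizer is unique and A is closed, by compactness this only requires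
   astar s' to stay bounded.

   Since A may be unbounded, astar could still escape to infinity near some states.
   This is excluded on each segment of S by a Baire argument: on an interval where
   astar is bounded it is Lipschitz, and if it were unbounded on a segment, then there
   would be nested intervals I_n with |astar| > n on I_n. *)
Require Import Defs.
From HB Require Import structures.
From mathcomp Require Import all_boot all_order all_algebra.
From mathcomp Require Import all_classical all_reals all_analysis.
From mathcomp Require Import ring lra.

Set Implicit Arguments.
Unset Strict Implicit.
Unset Printing Implicit Defensive.

Import Order.TTheory GRing.Theory Num.Theory.
Import numFieldNormedType.Exports.

Local Open Scope classical_set_scope.
Local Open Scope ring_scope.

(** * From local to global Lipschitz bounds on the real line *)

(* For a curve b, rho x y and h x play the roles of |b x - b y| and |b x|. *)
Definition pseudometric_on_line (R : realType) (rho : R -> R -> R) (h : R -> R) :=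
  [/\ forall x y, rho x y = rho y x,
      forall x y z, rho x z <= rho x y + rho y z &
      forall x y, h x <= h y + rho x y].

(** The neighbourhood of [t] depends on [B], so [h] may still blow up near [t]: only those points
    [u] where the height stays below [B] are controlled. *)
Definition lipschitz_where_bounded (R : realType) (rho : R -> R -> R)
    (h : R -> R) (C : R) :=
  forall t B, \forall u \near t, h u <= B -> rho t u <= C * `|t - u|.

(** Continuous induction: the set of [z] reached from [x] with the right bound contains its
    supremum, and if that supremum were less than [y], the local bound there would reach further. *)
Lemma bounded_lipschitz (R : realType) (rho : R -> R -> R) (h : R -> R) (C : R) :
  pseudometric_on_line rho h -> lipschitz_where_bounded rho h C ->
  forall x y B, x <= y -> (forall u, x <= u <= y -> h u <= B) ->
  rho x y <= C * (y - x).
Proof.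
move=> [rhoC rhoD _] H x y B xy hB.
pose E := [set z | x <= z <= y /\ rho x z <= C * (z - x)].
have Ex : E x.
  split; first by rewrite lexx.
  by have /nbhs_singleton /(_ (lexx _)) := H x (h x); rewrite subrr normr0 mulr0.
have Eub : ubound E y by move=> z [/andP[]].
have supE : has_sup E by split; [exists x | exists y].
set z := sup E.
have xz : x <= z by apply: ub_le_sup => //; exists y.
have zy : z <= y by apply: ge_sup => //; exists x.
have /nbhs_ballP[d /= d0 Hd] := H z B.
(* The supremum is attained: some [w] in [E] lies within [d] of [z], and the local bound at [z]
   covers the gap. *)
have Ez : rho x z <= C * (z - x).
  have [w [/andP[xw wy] Ew] zw] := sup_adherent d0 supE.
  have wz : w <= z by apply: ub_le_sup => //; [exists y | split=> //; rewrite xw].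
  have zwd : `|z - w| < d by rewrite ger0_norm ?subr_ge0// -/z in zw *; lra.
  have := Hd w zwd (hB w _); rewrite xw wy => /(_ isT).
  rewrite ger0_norm ?subr_ge0// rhoC => wzC.
  by have := rhoD x w z; rewrite -/z in wzC *; lra.
have [<- //|zNy] := eqVneq z y.
have {}zy : z < y by rewrite lt_neqAle zNy.
pose u := Num.min y (z + d / 2).
have zu : z < u by rewrite lt_min zy/=; lra.
have uy : u <= y by rewrite ge_min lexx.
have uz : u - z < d by rewrite ltrBlDl gt_min; apply/orP; right; lra.
have Eu : E u.
  split; first by rewrite (le_trans xz (ltW zu)).
  have zud : `|z - u| < d by rewrite distrC ger0_norm// subr_ge0 ltW.
  have := Hd u zud (hB u _); rewrite uy (le_trans xz (ltW zu)) => /(_ isT).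
  rewrite distrC ger0_norm ?subr_ge0 ?(ltW zu)// => zuC.
  by have := rhoD x z u; lra.
have : u <= z by apply: ub_le_sup => //; exists y.
by rewrite leNgt zu.
Qed.

(** A nearby [u] with [h u <= n] would be subject to the local bound, so [h] could drop by at most
    [C * |t - u|] between [t] and [u], which is less than [h t - n]. *)
Lemma gt_height_open (R : realType) (rho : R -> R -> R) (h : R -> R) (C : R) :
  0 <= C -> pseudometric_on_line rho h -> lipschitz_where_bounded rho h C ->
  forall t n, n < h t -> \forall u \near t, n < h u.
Proof.
move=> C0 [_ _ hD] H t n nt; near=> u.
have tuC : h u <= n -> rho t u <= C * `|t - u| by near: u; exact: H.
(* The denominator is [C + 1] so that [C = 0] is allowed. *)
have tu : `|t - u| < (h t - n) / (C + 1).
  near: u; apply: (@nbhsx_ballx _ _ t ((h t - n) / (C + 1))).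
  by rewrite divr_gt0 ?subr_gt0//; lra.
rewrite ltr_pdivlMr in tu; last by lra.
rewrite ltNge; apply/negP => un.
by have := hD t u; have := normr_ge0 (t - u); have := tuC un; nra.
Unshelve. all: by end_near. Qed.

(** Let [z] be the last point of [[p, t]] of height at most [n]. Beyond [z] the height exceeds [n],
    so the boundedness hypothesis makes the curve Lipschitz from [z] to [t], and the height grows by
    at most [C * (t - z)]. *)
Lemma height_growth (R : realType) (rho : R -> R -> R) (h : R -> R) (C : R) :
  0 <= C -> pseudometric_on_line rho h -> lipschitz_where_bounded rho h C ->
  forall p t n, p <= t -> h p <= n ->
  (forall u, p <= u <= t -> (forall v, u <= v <= t -> n < h v) ->
    exists B, forall v, u <= v <= t -> h v <= B) ->
  h t <= n + C * (t - p).
Proof.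
move=> C0 rhoP H p t n pt hp hbnd; have [_ _ hD] := rhoP.
have tp0 : 0 <= C * (t - p) by rewrite mulr_ge0// subr_ge0.
have [htn|nht] := leP (h t) n; first lra.
pose E := [set u | p <= u <= t /\ h u <= n].
have Ep : E p by split=> //; rewrite lexx.
have Eub : ubound E t by move=> u [/andP[]].
have supE : has_sup E by split; [exists p | exists t].
set z := sup E.
have pz : p <= z by apply: ub_le_sup => //; exists t.
have zt : z <= t by apply: ge_sup => //; exists p.
(* The supremum belongs to [E] because the set where [n < h] is open. *)
have hz : h z <= n.
  rewrite leNgt; apply/negP => /(gt_height_open C0 rhoP H)/nbhs_ballP[d /= d0 Hd].
  have [w [/andP[pw wt] hw] zw] := sup_adherent d0 supE.
  have wz : w <= z by apply: ub_le_sup => //; [exists t | split=> //; rewrite pw].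
  have zwd : `|z - w| < d by rewrite ger0_norm ?subr_ge0// -/z in zw *; lra.
  by have := Hd w zwd; rewrite ltNge hw.
have ztn u : z < u -> u <= t -> n < h u.
  move=> zu ut; rewrite ltNge; apply/negP => hu.
  have : u <= z.
    apply: ub_le_sup; first by exists t.
    by split=> //; rewrite ut (le_trans pz (ltW zu)).
  by rewrite leNgt zu.
(* The bound [B] given by the hypothesis depends on [u]. The Lipschitz estimate back from [t]
   replaces it by one uniform in [u], which then serves on all of [[z, t]]. *)
have hut u : z < u -> u <= t -> h u <= h t + C * (t - p).
  move=> zu ut.
  have [||B hB] := hbnd u; first by rewrite ut (le_trans pz (ltW zu)).
    by move=> v /andP[uv vt]; apply: ztn => //; apply: lt_le_trans uv.
  have := bounded_lipschitz rhoP H ut hB; have := hD u t.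
  have : C * (t - u) <= C * (t - p).
    by rewrite ler_wpM2l// lerD2l lerN2 (le_trans pz (ltW zu)).
  by lra.
have := @bounded_lipschitz _ _ _ _ rhoP H z t (Num.max n (h t + C * (t - p))) zt.
have -> : rho z t = rho t z by case: rhoP.
have ztp : C * (t - z) <= C * (t - p) by rewrite ler_wpM2l// lerD2l lerN2.
have := hD t z => htz; suff /[swap] /[apply] :
  forall u, z <= u <= t -> h u <= Num.max n (h t + C * (t - p)) by lra.
move=> u /andP[]; rewrite le_eqVlt => /predU1P[<- _|zu ut].
  by rewrite le_max hz.
by rewrite le_max hut ?orbT.
Qed.

(** Otherwise [h] is bounded on every subinterval where it exceeds [n], and [height_growth], started
    from a point of height at most [n], bounds [h] by [n + C * (y - x)] on all of [[x, y]]. *)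
Lemma unbounded_subinterval (R : realType) (rho : R -> R -> R) (h : R -> R) (C : R) :
  0 <= C -> pseudometric_on_line rho h -> lipschitz_where_bounded rho h C ->
  forall x y n, (forall B, exists2 u, x <= u <= y & B < h u) ->
  exists x' y', [/\ x <= x' <= y', y' <= y, (forall u, x' <= u <= y' -> n < h u) &
    forall B, exists2 u, x' <= u <= y' & B < h u].
Proof.
move=> C0 rhoP H x y n unbnd; apply: contrapT => noSub.
have bnd u v : x <= u <= v -> v <= y -> (forall w, u <= w <= v -> n < h w) ->
    exists B, forall w, u <= w <= v -> h w <= B.
  move=> xuv vy nuv; apply: contrapT => unb; apply: noSub; exists u, v; split=> // B.
  apply: contrapT => nB; apply: unb; exists B => w uwv.
  by rewrite leNgt; apply/negP => Bw; apply: nB; exists w.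
have [u0 /andP[xu0 u0y] _] := unbnd 0.
have xy := le_trans xu0 u0y.
(* Without a starting point [p], the interval [[x, y]] is itself a subinterval of the kind
   sought. *)
have [[p [/andP[xp py] hp]]|nop] := pselect (exists p, x <= p <= y /\ h p <= n); last first.
  apply: noSub; exists x, y; split=> //; first by rewrite lexx.
  by move=> u xuy; rewrite ltNge; apply/negP => hu; apply: nop; exists u.
have [t /andP[xt ty]] := unbnd (n + C * (y - x)); apply/negP; rewrite -leNgt.
have [pt|/ltW tp] := leP p t.
  apply: (@le_trans _ _ (n + C * (t - p))); last by rewrite lerD2l ler_wpM2l//; lra.
  apply: (height_growth C0 rhoP H pt hp) => u /andP[pu ut] nu.
  by apply: bnd => //; rewrite ut (le_trans xp pu).
(* For [t] to the left of [p], the growth estimate is applied to the curve reflected by [x] to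
   [- x]. *)
apply: (@le_trans _ _ (n + C * (- t - - p))); last by rewrite lerD2l ler_wpM2l//; lra.
have [rhoC rhoD hD] := rhoP.
have := @height_growth R (fun x y => rho (- x) (- y)) (fun x => h (- x)) C C0 _ _
  (- p) (- t) n.
rewrite !opprK; apply => //; rewrite ?lerN2//.
- move=> s B; have Hs : \forall w \near s, h (- w) <= B ->
      rho (- s) (- w) <= C * `|- s - - w| by exact: (@opp_continuous R s) _ (H (- s) B).
  apply: filterS Hs => w /= + hw => /(_ hw) /le_trans; apply.
  by rewrite -opprD normrN.
- move=> u /andP[pu ut] nu.
  have [||w|B hB] := bnd t (- u); rewrite ?xt/=; [lra|lra| |].
    by move=> /andP[tw wu]; rewrite -[w]opprK; apply: nu; lra.
  by exists B => v /andP[uv vt]; apply: hB; lra.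
Qed.

(** If [h] is bounded on [[x, y]], [bounded_lipschitz] suffices. Otherwise [unbounded_subinterval]
    can be iterated, and a common point of the nested intervals would have infinite height. *)
Lemma lipschitz_of_lipschitz_where_bounded (R : realType) (rho : R -> R -> R)
    (h : R -> R) (C : R) :
  0 <= C -> pseudometric_on_line rho h -> lipschitz_where_bounded rho h C ->
  forall x y, x <= y -> rho x y <= C * (y - x).
Proof.
move=> C0 rhoP H x y xy.
have [[B hB]|unb] := pselect (exists B, forall u, x <= u <= y -> h u <= B).
  exact: bounded_lipschitz rhoP H _ _ _ xy hB.
pose bad (I : R * R) := forall B, exists2 u, I.1 <= u <= I.2 & B < h u.
have badxy : bad (x, y).
  move=> B; apply: contrapT => nB; apply: unb; exists B => w uwv.
  by rewrite leNgt; apply/negP => Bw; apply: nB; exists w.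
(* The implication makes [next] a total function; on an interval that is not bad its value is
   arbitrary. *)
have /choice[next nextP] : forall nI : nat * (R * R), exists J : R * R, bad nI.2 ->
    [/\ nI.2.1 <= J.1 <= J.2, J.2 <= nI.2.2,
      (forall u, J.1 <= u <= J.2 -> nI.1%:R < h u) & bad J].
  move=> [n [u v]] /=; have [bI|nbI] := pselect (bad (u, v)); last by exists (u, v).
  have [u' [v' ?]] := unbounded_subinterval C0 rhoP H n%:R bI.
  by exists (u', v').
pose I := fix I n := if n is m.+1 then next (m, I m) else (x, y).
have Ibad n : bad (I n) by elim: n => // n IHn; have [] := nextP (n, I n) IHn.
have IP n := nextP (n, I n) (Ibad n).
have Ile n : (I n).1 <= (I n).2.
  by have [u /andP[Iu uI] _] := Ibad n 0; exact: le_trans Iu uI.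
have I1 : {homo (fun n => (I n).1) : m n / (m <= n)%N >-> m <= n}.
  by apply: homo_leq => // [?|n]; [exact: le_trans|have [/andP[]] := IP n].
have I2 : {homo (fun n => (I n).2) : m n / (m <= n)%N >-> n <= m}.
  by apply: homo_leq => // [u v w vu wv|n]; [exact: le_trans wv vu|have [] := IP n].
have I12 m n : (I m).1 <= (I n).2.
  apply: le_trans (I1 _ _ (leq_maxl m n)) _.
  exact: le_trans (Ile _) (I2 _ _ (leq_maxr m n)).
pose E := range (fun n => (I n).1).
(* The index is shifted by one: the step from [I n] to [I n.+1] is the one that forces [h] above
   [n]. *)
have hn n : n%:R < h (sup E).
  have [_ _ + _] := IP n; apply; apply/andP; split.
    by apply: ub_le_sup; [exists (I 0%N).2 => _ [m _ <-]; exact: I12 | exists n.+1].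
  by apply: ge_sup; [exists (I 0%N).1; exists 0%N | move=> _ [m _ <-]; exact: (I12 m n.+1)].
have := hn (Num.bound `|h (sup E)|); apply: contraTT => _; rewrite -leNgt ltW//.
exact: le_lt_trans (ler_norm _) (archi_boundP (normr_ge0 _)).
Qed.

(** * Euclidean norm, inner product and spectral norm *)

Definition dot (R : realType) (n : nat) (x y : 'cV[R]_n) : R :=
  \sum_(i < n) x i 0 * y i 0.

Lemma dotC (R : realType) n (x y : 'cV[R]_n) : dot x y = dot y x.
Proof. by apply: eq_bigr => i _; rewrite mulrC. Qed.

Lemma dotDl (R : realType) n (x y z : 'cV[R]_n) : dot (x + y) z = dot x z + dot y z.
Proof. by rewrite -big_split; apply: eq_bigr => i _; rewrite mxE mulrDl. Qed.

Lemma dotZl (R : realType) n c (x y : 'cV[R]_n) : dot (c *: x) y = c * dot x y.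
Proof. by rewrite mulr_sumr; apply: eq_bigr => i _; rewrite mxE mulrA. Qed.

Lemma dotDr (R : realType) n (x y z : 'cV[R]_n) : dot x (y + z) = dot x y + dot x z.
Proof. by rewrite dotC dotDl !(dotC _ x). Qed.

Lemma dotZr (R : realType) n c (x y : 'cV[R]_n) : dot x (c *: y) = c * dot x y.
Proof. by rewrite dotC dotZl dotC. Qed.

Lemma dot_mulmx (R : realType) m n (A : 'M[R]_(m, n)) x y :
  dot (A^T *m x) y = dot x (A *m y).
Proof.
rewrite /dot; under eq_bigr do rewrite mxE mulr_suml; rewrite exchange_big/=.
apply: eq_bigr => i _; rewrite mxE mulr_sumr; apply: eq_bigr => j _.
by rewrite mxE mulrCA mulrA.
Qed.

Lemma enorm_ge0 (R : realType) n (x : 'cV[R]_n) : 0 <= enorm x.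
Proof. exact: sqrtr_ge0. Qed.

Lemma sqr_enorm (R : realType) n (x : 'cV[R]_n) : enorm x ^+ 2 = dot x x.
Proof. by rewrite sqr_sqrtr// sumr_ge0// => i _; exact: sqr_ge0. Qed.

Lemma enorm_eq0 (R : realType) n (x : 'cV[R]_n) : (enorm x == 0) = (x == 0).
Proof.
apply/eqP/eqP => [x0|->]; last first.
  by rewrite /enorm big1 ?sqrtr0// => i _; rewrite mxE expr0n.
apply/colP => i; rewrite mxE; apply/eqP; rewrite -sqrf_eq0; apply/eqP.
have := sqr_enorm x; rewrite x0 expr0n => /esym/eqP.
by rewrite psumr_eq0 => [/allP/(_ i (mem_index_enum _))/eqP//|j _]; exact: sqr_ge0.
Qed.

Lemma enormZ (R : realType) n c (x : 'cV[R]_n) : enorm (c *: x) = `|c| * enorm x.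
Proof.
apply/eqP; rewrite -(eqrXn2 (n:=2))// ?mulr_ge0 ?enorm_ge0//.
by rewrite exprMn !sqr_enorm real_normK ?num_real// dotZl dotZr mulrA.
Qed.

Lemma enormN (R : realType) n (x : 'cV[R]_n) : enorm (- x) = enorm x.
Proof. by rewrite -scaleN1r enormZ normrN1 mul1r. Qed.

(** Cauchy-Schwarz, by expanding the squared norm of [|y| x - |x| y], which is
    [2 |x| |y| (|x| |y| - dot x y)]. *)
Lemma dot_le_enorm (R : realType) n (x y : 'cV[R]_n) : dot x y <= enorm x * enorm y.
Proof.
have [->|x0] := eqVneq x 0.
  by rewrite -(scale0r 0) dotZl mul0r mulr_ge0 ?enorm_ge0.
have [->|y0] := eqVneq y 0.
  by rewrite -(scale0r 0) dotZr mul0r mulr_ge0 ?enorm_ge0.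
have px : 0 < enorm x by rewrite lt_def enorm_ge0 enorm_eq0 x0.
have py : 0 < enorm y by rewrite lt_def enorm_ge0 enorm_eq0 y0.
have := sqr_ge0 (enorm (enorm y *: x + (- enorm x) *: y)).
rewrite sqr_enorm !(dotDl, dotDr, dotZl, dotZr) -!sqr_enorm (dotC y x) => h.
have : 0 <= (2 * (enorm x * enorm y)) * (enorm x * enorm y - dot x y) by lra.
by rewrite pmulr_rge0 ?subr_ge0// !mulr_gt0.
Qed.

Lemma enormD (R : realType) n (x y : 'cV[R]_n) : enorm (x + y) <= enorm x + enorm y.
Proof.
rewrite -(@ler_pXn2r _ 2)// ?nnegrE ?addr_ge0 ?enorm_ge0//.
rewrite sqr_enorm dotDl !dotDr -!sqr_enorm (dotC y x).
by have := dot_le_enorm x y; lra.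
Qed.

Lemma normr_dot_le_enorm (R : realType) n (x y : 'cV[R]_n) :
  `|dot x y| <= enorm x * enorm y.
Proof.
by rewrite ler_norml dot_le_enorm andbT lerNl
  -mulN1r -dotZl scaleN1r -(enormN x) dot_le_enorm.
Qed.

Lemma coord_le_enorm (R : realType) n (x : 'cV[R]_n) i : `|x i 0| <= enorm x.
Proof.
rewrite -(@ler_pXn2r _ 2)// ?nnegrE ?enorm_ge0// real_normK ?num_real//.
by rewrite sqr_enorm /dot (bigD1 i)//= -expr2 lerDl sumr_ge0// => j _; exact: sqr_ge0.
Qed.

(** Balls and neighbourhoods refer to the maximum norm. This comparison and [enorm_le_norm]
    translate between them and Euclidean estimates. *)
Lemma norm_le_enorm (R : realType) n (x : 'cV[R]_n) : `|x| <= enorm x.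
Proof.
rewrite {1}/Num.norm/= mx_normrE; apply: bigmax_le; first exact: enorm_ge0.
by move=> [i j] _ /=; rewrite ord1 coord_le_enorm.
Qed.

Lemma coord_le_norm (R : realType) n (x : 'cV[R]_n) i : `|x i 0| <= `|x|.
Proof.
rewrite {2}/Num.norm/= mx_normrE.
exact: (le_bigmax _ (fun ij : 'I_n * 'I_1 => `|x ij.1 ij.2|) (i, 0)).
Qed.

Lemma enorm_le_norm (R : realType) n (x : 'cV[R]_n) :
  enorm x <= Num.sqrt n%:R * `|x|.
Proof.
rewrite -(@ler_pXn2r _ 2)// ?nnegrE ?enorm_ge0// ?mulr_ge0 ?sqrtr_ge0//.
rewrite sqr_enorm exprMn sqr_sqrtr ?ler0n// mulr_natl.
rewrite -[X in _ *+ X]card_ord -sumr_const; apply: ler_sum => i _.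
by rewrite -expr2 -[X in X <= _]real_normK ?num_real// ler_pXn2r ?nnegrE// coord_le_norm.
Qed.

(** The Frobenius norm is an upper bound, by Cauchy-Schwarz on each row. Boundedness is what makes
    the [sup] in [spectral_norm] a genuine supremum. *)
Lemma has_ubound_spectral_norm (R : realType) m n (A : 'M[R]_(m, n)) :
  has_ubound [set enorm (A *m x) | x in [set x : 'cV[R]_n | enorm x <= 1]].
Proof.
exists (Num.sqrt (\sum_(i < m) enorm (row i A)^T ^+ 2)) => _ [y y1 <-].
rewrite ler_wsqrtr//; apply: ler_sum => i _.
have -> : (A *m y) i 0 = dot (row i A)^T y.
  by rewrite mxE; apply: eq_bigr => j _; rewrite !mxE.
rewrite -[X in X <= _]real_normK ?num_real// ler_pXn2r ?nnegrE ?enorm_ge0//.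
by rewrite (le_trans (normr_dot_le_enorm _ _))// ler_piMr// enorm_ge0.
Qed.

Lemma enorm0 (R : realType) n : enorm (0 : 'cV[R]_n) = 0.
Proof. by apply/eqP; rewrite enorm_eq0. Qed.

Lemma spectral_norm_ge0 (R : realType) m n (A : 'M[R]_(m, n)) : 0 <= spectral_norm A.
Proof.
apply: (ub_le_sup (has_ubound_spectral_norm A)).
by exists 0; rewrite /= ?mulmx0 enorm0.
Qed.

Lemma enorm_mulmx_le (R : realType) m n (A : 'M[R]_(m, n)) x :
  enorm (A *m x) <= spectral_norm A * enorm x.
Proof.
have [->|x0] := eqVneq x 0; first by rewrite mulmx0 !enorm0 mulr0.
have px : 0 < enorm x by rewrite lt_def enorm_ge0 enorm_eq0 x0.
rewrite -ler_pdivrMr//.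
have -> : enorm (A *m x) / enorm x = enorm (A *m ((enorm x)^-1 *: x)).
  by rewrite -scalemxAr enormZ ger0_norm ?invr_ge0 ?enorm_ge0// mulrC.
apply: (ub_le_sup (has_ubound_spectral_norm A)); exists ((enorm x)^-1 *: x) => //=.
by rewrite enormZ ger0_norm ?invr_ge0 ?enorm_ge0// mulVf// gt_eqF.
Qed.

(** * Compactness and the Rayleigh quotient *)

(** Transposition preserves the maximum norm, which reduces the claim to Heine-Borel for row
    vectors. *)
Lemma bounded_closed_compact_cV (R : realType) n (K : set 'cV[R]_n) B :
  closed K -> (forall x, K x -> `|x| <= B) -> compact K.
Proof.
move=> clK bK.
have tr_norm p q (x : 'M[R]_(p, q)) : `|x^T| <= `|x|.
  rewrite {1}/Num.norm/= mx_normrE; apply: bigmax_le => // -[i j] _ /=.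
  rewrite mxE [leRHS]/Num.norm/= mx_normrE.
  exact: (le_bigmax _ (fun ij : 'I_p * 'I_q => `|x ij.1 ij.2|) (j, i)).
have tr_cont p q : continuous (fun x : 'M[R]_(p, q) => x^T).
  move=> x P /nbhs_ballP[e /= e0 eP]; apply/nbhs_ballP; exists e => // y [_ xy].
  by apply: eP; split=> // i j; rewrite !mxE.
pose K' := [set x : 'rV[R]_n | K x^T].
have -> : K = (fun x : 'rV[R]_n => x^T) @` K'.
  apply/seteqP; split => [x Kx|_ [x Kx <-]//].
  by exists x^T; rewrite /K' /= trmxK.
apply: continuous_compact; first exact/continuous_subspaceT/tr_cont.
apply: bounded_closed_compact.
  exists B; split; first exact: num_real.
  move=> M BM x /bK Kx; have := tr_norm _ _ x^T; rewrite trmxK => /le_trans; apply.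
  exact: le_trans Kx (ltW BM).
by apply: preimage_closed => // x _; exact: tr_cont.
Qed.

Lemma continuous_sumr (R : realType) (T : topologicalType) n (f : 'I_n -> T -> R) :
  (forall i, continuous (f i)) -> continuous (fun x => \sum_(i < n) f i x).
Proof.
move=> cf; have -> : (fun x => \sum_(i < n) f i x) = \sum_(i < n) f i.
  by apply/funext => x; rewrite fct_sumE.
apply: (big_ind (fun g : T -> R => continuous g)) => //.
  by move=> x; exact: cst_continuous.
by move=> g h cg ch x; apply: continuousD; [exact: cg|exact: ch].
Qed.

Lemma dot_continuous (R : realType) (T : topologicalType) n (f g : T -> 'cV[R]_n) :
  (forall i, continuous (fun x => f x i 0)) -> (forall i, continuous (fun x => g x i 0)) ->
  continuous (fun x => dot (f x) (g x)).
Proof.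
move=> cf cg; apply: continuous_sumr => i x.
by apply: continuousM; [exact: cf|exact: cg].
Qed.

Lemma mulmx_coord_continuous (R : realType) m n (A : 'M[R]_(m, n)) i :
  continuous (fun x : 'cV[R]_n => (A *m x) i 0).
Proof.
have -> : (fun x : 'cV[R]_n => (A *m x) i 0) = (fun x => \sum_j A i j * x j 0).
  by apply/funext => x; rewrite mxE.
apply: continuous_sumr => j x; apply: continuousM; first exact: cst_continuous.
exact: coord_continuous.
Qed.

(* Rayleigh: the maximum of the quadratic form on the unit sphere is attained
   at an eigenvector. *)
Lemma dot_le_lambda_max (R : realType) n (H : 'M[R]_n) (x : 'cV[R]_n) :
  H^T = H -> dot x (H *m x) <= lambda_max H * enorm x ^+ 2.
Proof.
move=> Hsym.
(* This case includes [n = 0], where the unit sphere is empty; a nonzero [x] provides a point of the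
   sphere. *)
have [->|x0] := eqVneq x 0.
  by rewrite mulmx0 sqr_enorm -(scale0r 0) !dotZl !mul0r mulr0.
have normalize (y : 'cV[R]_n) : y != 0 -> enorm ((enorm y)^-1 *: y) = 1.
  move=> y0; rewrite enormZ ger0_norm ?invr_ge0 ?enorm_ge0// mulVf//.
  by rewrite enorm_eq0.
pose S := [set y : 'cV[R]_n | dot y y = 1].
have Sx : S !=set0.
  by exists ((enorm x)^-1 *: x); rewrite /S/= -sqr_enorm normalize// expr1n.
have cS : compact S.
  apply: (@bounded_closed_compact_cV _ _ _ 1).
    apply: (@preimage_closed _ _ (fun y : 'cV[R]_n => dot y y) [set 1]).
      by move=> y _; apply: dot_continuous => i; exact: coord_continuous.
    exact: closed_eq.
  move=> y /= y1; rewrite (le_trans (norm_le_enorm _))//.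
  by rewrite -(@ler_pXn2r _ 2)// ?nnegrE ?enorm_ge0// sqr_enorm y1 expr1n.
have qc : continuous (fun y : 'cV[R]_n => dot y (H *m y)).
  apply: dot_continuous => i; first exact: coord_continuous.
  exact: mulmx_coord_continuous.
have [u] := compact_EVT_max Sx cS (continuous_subspaceT qc).
rewrite inE /S/= => u1 umax.
pose l := dot u (H *m u).
have ql y : dot y (H *m y) <= l * dot y y.
  have [->|y0] := eqVneq y 0.
    by rewrite mulmx0 -(scale0r 0) !dotZl !mul0r mulr0.
  have yy0 : 0 < dot y y by rewrite -sqr_enorm exprn_gt0// lt_def enorm_ge0 enorm_eq0 y0.
  have := umax ((enorm y)^-1 *: y).
  rewrite inE /S/= -sqr_enorm normalize// expr1n => /(_ erefl).
  rewrite -scalemxAr dotZl dotZr -/l mulrA -expr2 exprVn sqr_enorm.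
  by rewrite (ler_pdivrMl _ _ yy0) (mulrC l).
have Hu : H *m u = l *: u.
  (* The residual [y] is shown to vanish by comparing [u] with [u + t y]: maximality gives
     [0 <= t^2 b + 2 t |y|^2] for every real [t]. *)
  pose y := l *: u - H *m u.
  have Huy : dot u (H *m y) = dot y (H *m u) by rewrite -{1}Hsym -dot_mulmx trmxK dotC.
  suff /eqP : dot y y = 0.
    by rewrite -sqr_enorm sqrf_eq0 enorm_eq0 subr_eq0 => /eqP.
  have yy : dot y y = l * dot u y - dot y (H *m u).
    by rewrite {1}/y -scaleN1r dotDl !dotZl mulN1r (dotC (H *m u)).
  clearbody y; pose b := l * dot y y - dot y (H *m y).
  have b0 : 0 <= b by rewrite subr_ge0 ql.
  have quad t : 0 <= t ^+ 2 * b + 2 * t * dot y y.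
    have := ql (u + t *: y); rewrite mulmxDr -scalemxAr.
    rewrite !(dotDl, dotDr, dotZl, dotZr)
      Huy u1 -/l (dotC y u) /b yy; lra.
  have d0 : 0 <= dot y y by rewrite -sqr_enorm sqr_ge0.
  (* A negative [t] small enough for the linear term to dominate; [b + 1] is positive even if
     [b = 0]. *)
  have := quad (- (dot y y) / (b + 1)).
  have b1 : b + 1 != 0 by rewrite gt_eqF//; lra.
  have -> : (- dot y y / (b + 1)) ^+ 2 * b + 2 * (- dot y y / (b + 1)) * dot y y =
    - (dot y y ^+ 2 * ((b + 2) / (b + 1) ^+ 2)) by field.
  rewrite oppr_ge0 pmulr_lle0; last by rewrite divr_gt0 ?exprn_gt0//; lra.
  by move=> y2; apply/eqP; rewrite -sqrf_eq0 eq_le y2 sqr_ge0.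
have lmax : l <= lambda_max H.
  (* The maximum [l] bounds all eigenvalues and is one of them. Since [eigenvalue] is about row
     vectors, the symmetry of [H] is used to transpose. *)
  apply: ub_le_sup.
    exists l => l' /= /eigenvalueP[v vH v0].
    have := ql v^T.
    have -> : H *m v^T = l' *: v^T by rewrite -{1}Hsym -trmx_mul vH linearZ.
    rewrite dotZr ler_pM2r// -sqr_enorm exprn_gt0// lt_def enorm_ge0 enorm_eq0 andbT.
    by apply: contra v0 => /eqP v0; rewrite -[v]trmxK v0 trmx0.
  apply/eigenvalueP; exists u^T; first by rewrite -{1}Hsym -trmx_mul Hu linearZ.
  apply/eqP => u0; move: u1; rewrite -[u]trmxK u0 trmx0 -(scale0r 0) dotZl mul0r.
  by move/esym/eqP; rewrite oner_eq0.
by rewrite (le_trans (ql x))// sqr_enorm ler_wpM2r// -sqr_enorm sqr_ge0.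
Qed.

(** * Directional derivatives and symmetry of the second derivative *)

(** Both derivatives are limits of literally the same difference quotient. *)
Lemma is_derive_along (R : realType) (V : normedModType R) (f : V -> R) p v (t : R) :
  differentiable f (p + t *: v) ->
  is_derive t 1 (fun s => f (p + s *: v)) ('D_v f (p + t *: v)).
Proof.
move=> fx; have df : derivable f (p + t *: v) v by exact: diff_derivable.
have shiftE : (fun h : R => h^-1 *: (((fun s : R => f (p + s *: v)) \o shift t) (h *: 1)
      - f (p + t *: v))) =
    (fun h : R => h^-1 *: ((f \o shift (p + t *: v)) (h *: v) - f (p + t *: v))).
  by apply/funext => h /=; rewrite /shift /= [h *: 1]mulr1 scalerDl addrCA.
by apply: DeriveDef; [rewrite /derivable shiftE | rewrite /derive shiftE].
Qed.

(** Fermat's rule for the restriction of [f] to a line. It needs derivability on an interval around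
    [0], hence differentiability near [p]. *)
Lemma derive_eq0_at_local_max (R : realType) (V : normedModType R) (f : V -> R) p v :
  (\forall x \near p, differentiable f x) ->
  (\forall t \near (0 : R), f (p + t *: v) <= f p) -> 'D_v f p = 0.
Proof.
move=> df fmax.
have line_cvg : (fun t : R => p + t *: v) @ (0 : R) --> p.
  rewrite -[X in _ --> X]addr0 -(scale0r v).
  by apply: cvgD; [exact: cvg_cst | apply: cvgZr_tmp; exact: cvg_id].
have : \forall t \near (0 : R), f (p + t *: v) <= f p /\ differentiable f (p + t *: v).
  by near=> t; split; near: t => //; exact: (line_cvg _ df).
move=> /nbhs_ballP[e /= e0 He].
have H t : t \in `]- e, e[ -> f (p + t *: v) <= f p /\ differentiable f (p + t *: v).
  rewrite in_itv/= => te; apply: He.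
  by rewrite -ball_normE/= sub0r normrN ltr_norml.
have e00 : 0 \in `]- e, e[ by rewrite in_itv/= oppr_lt0 e0.
have := @derive1_at_max _ (fun t => f (p + t *: v)) (- e) e 0 _ _ e00 _.
have -> : f (p + 0 *: v) = f p by rewrite scale0r addr0.
move=> [||t te|_ <-]; first lra.
- by move=> t /H[_ /is_derive_along []].
- by have [] := H t te.
- by have [_ /is_derive_along []] := H 0 e00; rewrite scale0r addr0.
Unshelve. all: by end_near. Qed.

(** The mean value theorem is used twice: in [s] for the increment
    [f (p + h v + s u) - f (p + s u)], then in [t] for the derivative along [u] at
    [p + s u + t v]. *)
Lemma second_difference (R : realType) (V : normedModType R) (U : set V) (f : V -> R)
    p u v (h : R) :
  C2_on U f -> 0 < h ->
  (forall s t : R, 0 <= s <= h -> 0 <= t <= h -> U (p + s *: u + t *: v)) ->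
  exists s t : R, [/\ 0 <= s <= h, 0 <= t <= h &
    f (p + h *: u + h *: v) - f (p + h *: u) - (f (p + h *: v) - f p)
      = h ^+ 2 * 'D_v ('D_u f) (p + s *: u + t *: v)].
Proof.
move=> [f1 f2] h0 HU.
have hh : 0 <= h <= h by rewrite ltW/=.
have z0 : 0 <= (0 : R) <= h by rewrite lexx ltW.
pose phi (s : R) := f (p + h *: v + s *: u) - f (p + s *: u).
have dphi s : 0 <= s <= h ->
    is_derive s 1 phi ('D_u f (p + h *: v + s *: u) - 'D_u f (p + s *: u)).
  move=> s0h; apply: is_deriveB; apply: is_derive_along.
    by have [] := f1 _ (HU s h s0h hh); rewrite addrAC.
  by have [] := f1 _ (HU s 0 s0h z0); rewrite scale0r addr0.
have [||s] := @MVT_segment _ phi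
  (fun s => 'D_u f (p + h *: v + s *: u) - 'D_u f (p + s *: u)) 0 h (ltW h0).
- by move=> s; rewrite in_itv/= => /andP[s0 sh]; apply: dphi; rewrite (ltW s0) ltW.
- apply: derivable_within_continuous => s; rewrite in_itv/= => /dphi.
  by case.
rewrite in_itv/= subr0 => sh phiE.
pose psi (t : R) := 'D_u f (p + s *: u + t *: v).
have dpsi t : 0 <= t <= h -> is_derive t 1 psi ('D_v ('D_u f) (p + s *: u + t *: v)).
  by move=> th; apply: is_derive_along; have [] := f2 u _ (HU s t sh th).
have [||t] := @MVT_segment _ psi
  (fun t => 'D_v ('D_u f) (p + s *: u + t *: v)) 0 h (ltW h0).
- by move=> t; rewrite in_itv/= => /andP[t0 th]; apply: dpsi; rewrite (ltW t0) ltW.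
- apply: derivable_within_continuous => t; rewrite in_itv/= => /dpsi.
  by case.
rewrite in_itv/= subr0 => th psiE.
exists s, t; split=> //.
have : phi h - phi 0 = (psi h - psi 0) * h.
  by rewrite phiE /psi scale0r addr0 [p + h *: v + _]addrAC.
rewrite psiE /phi scale0r !addr0 [p + h *: v + _]addrAC => ->.
ring.
Qed.

(** Schwarz's theorem: the second difference is symmetric in [u] and [v], so the two mixed
    derivatives take a common value at two points close to [p], and both are continuous at [p]. *)
Lemma derive2C (R : realType) (V : normedModType R) (U : set V) (f : V -> R) p u v :
  open U -> C2_on U f -> U p -> 'D_v ('D_u f) p = 'D_u ('D_v f) p.
Proof.
move=> oU f2 Up.
have cont w w' : {for p, continuous ('D_w ('D_w' f))}.
  by case: f2 => _ /(_ w' p Up)[].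
apply/eqP; rewrite -subr_eq0 -normr_le0; apply/ler_addgt0Pl => e e0; rewrite addr0.
have e2 : 0 < e / 2 by lra.
have nU : \forall x \near p, U x by exact: open_nbhs_nbhs.
have nvu : \forall x \near p, `|'D_v ('D_u f) p - 'D_v ('D_u f) x| < e / 2.
  exact: (@cvgr_dist_lt _ _ _ _ _ ('D_v ('D_u f)) _ (cont v u) _ e2).
have nuv : \forall x \near p, `|'D_u ('D_v f) p - 'D_u ('D_v f) x| < e / 2.
  exact: (@cvgr_dist_lt _ _ _ _ _ ('D_u ('D_v f)) _ (cont u v) _ e2).
have [d /= d0 Hd] := (nbhs_ballP p _).1 (filterI nU (filterI nvu nuv)).
(* With this side length the parallelogram at [p] stays in the ball of radius [d]. *)
pose h := d / (2 * (`|u| + `|v| + 1)).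
have n0 : 0 < `|u| + `|v| + 1 by have := normr_ge0 u; have := normr_ge0 v; lra.
have h0 : 0 < h by rewrite divr_gt0// mulr_gt0.
have near_p s t w w' : 0 <= s <= h -> 0 <= t <= h ->
    `|w| + `|w'| <= `|u| + `|v| -> ball p d (p + s *: w + t *: w').
  move=> /andP[s0 sh] /andP[t0 th] ww; rewrite -ball_normE/= -addrA opprD addNKr normrN.
  rewrite (le_lt_trans (ler_normD _ _))// !normrZ !ger0_norm//.
  have : h * (`|u| + `|v| + 1) = d / 2 by rewrite /h; field; rewrite gt_eqF.
  have := normr_ge0 w; have := normr_ge0 w'; nra.
have [|s [t [sh th E1]]] := @second_difference _ _ U f p u v h f2 h0.
  by move=> s t sh th; have [] := Hd _ (near_p s t u v sh th (lexx _)).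
have [|s' [t' [sh' th' E2]]] := @second_difference _ _ U f p v u h f2 h0.
  move=> s' t' sh' th'.
  by have [] := Hd _ (near_p s' t' v u sh' th' _); rewrite // addrC.
have E : 'D_v ('D_u f) (p + s *: u + t *: v) = 'D_u ('D_v f) (p + s' *: v + t' *: u).
  apply: (@mulfI _ (h ^+ 2)); first by rewrite expf_neq0// gt_eqF.
  apply: etrans (esym E1) _; apply: etrans _ E2.
  by rewrite [p + h *: v + h *: u]addrAC; ring.
have [_ [+ _]] := Hd _ (near_p s t u v sh th (lexx _)).
have [|_ [_]] := Hd _ (near_p s' t' v u sh' th' _); first by rewrite addrC.
rewrite -E => yz xz; rewrite [e]splitr.
apply: le_trans (ler_distD ('D_v ('D_u f) (p + s *: u + t *: v)) _ _) _.
apply: lerD (ltW xz) _; rewrite distrC; exact: (ltW yz).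
Qed.

Lemma differentiable_estimate (R : realType) (V : normedModType R) (f : V -> R) p e :
  differentiable f p -> 0 < e ->
  \forall x \near p, `|f x - f p - 'D_(x - p) f p| <= e * `|x - p|.
Proof.
move=> df e0.
have [_ /eqaddoP/(_ e e0) Ho] := (diff_locallyP _ _).1 df.
have [d /= d0 Hd] := (nbhs_ballP 0 _).1 Ho.
apply/nbhs_ballP; exists d => //= x px.
have := Hd (x - p); rewrite -ball_normE/= sub0r opprB.
rewrite -ball_normE/= in px; move=> /(_ px).
by rewrite deriveE// /shift/= !fctE subrK opprD addrA.
Qed.

(** * Expansion of the action gradient and the local estimate for the maximizer *)

Definition action_gradient (R : realType) (k d : nat)
    (Q : 'cV[R]_k * 'cV[R]_d -> R) (z : 'cV[R]_k * 'cV[R]_d) : 'cV[R]_d :=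
  \col_(i < d) 'D_(dir_a R k i) Q z.

(** The differential is linear, and [(x, y)] decomposes along the directions [dir_s] and [dir_a]. *)
Lemma derive_hess (R : realType) (k d : nat) (Q : 'cV[R]_k * 'cV[R]_d -> R) s a i x y :
  differentiable ('D_(dir_a R k i) Q) (s, a) ->
  'D_(x, y) ('D_(dir_a R k i) Q) (s, a) =
  (hess_sa Q s a *m x + hess_aa Q s a *m y) i 0.
Proof.
move=> dG; rewrite deriveE//.
have -> : (x, y) = \sum_j x j 0 *: dir_s R d j + \sum_j y j 0 *: dir_a R k j.
  rewrite [X in (X, _)](_ : x = \sum_j x j 0 *: delta_mx j 0); last first.
    by rewrite {1}[x]matrix_sum_delta; apply: eq_bigr => j _; rewrite big_ord1.
  rewrite [X in (_, X)](_ : y = \sum_j y j 0 *: delta_mx j 0); last first.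
    by rewrite {1}[y]matrix_sum_delta; apply: eq_bigr => j _; rewrite big_ord1.
  rewrite [LHS]surjective_pairing [RHS]surjective_pairing /=.
  congr (_, _); rewrite ?raddfD/= ?raddf_sum.
  - by rewrite [X in _ + X]big1 ?addr0// => j _ /=; rewrite scaler0.
  - by rewrite [X in X + _]big1 ?add0r// => j _ /=; rewrite scaler0.
rewrite linearD !linear_sum/= [RHS]mxE; congr (_ + _).
- rewrite mxE; apply: eq_bigr => j _.
  by rewrite linearZ/= !mxE deriveE// mulrC.
- rewrite mxE; apply: eq_bigr => j _.
  by rewrite linearZ/= !mxE deriveE// mulrC.
Qed.

(** Candidates in [A] of norm at most [B] and at distance at least [e] from [astar s] form a compact
    set. By uniqueness all are strictly worse than [astar s] at [s], and by compactness they remain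
    worse for all [s'] near [s], so none of them is [astar s']. *)
Lemma argmax_nearby (R : realType) (k d : nat) (S : set 'cV[R]_k) (A : set 'cV[R]_d)
    (Q : 'cV[R]_k * 'cV[R]_d -> R) (astar : 'cV[R]_k -> 'cV[R]_d) s B e :
  closed A -> (forall a, A a -> {for (s, a), continuous Q}) ->
  (forall s, S s -> argmax A (fun a => Q (s, a)) = [set astar s]) ->
  S s -> 0 < e ->
  \forall s' \near s, S s' -> enorm (astar s') <= B -> `|astar s - astar s'| < e.
Proof.
move=> clA cQ aP Ss e0.
have aA s' : S s' -> A (astar s') /\ forall b, A b -> Q (s', b) <= Q (s', astar s').
  by move=> /aP/seteqP[_ /(_ _ erefl)].
pose K := A `&` [set a | `|a| <= B] `&` [set a | e <= `|astar s - a|].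
have clK : closed K.
  apply: closedI.
    apply: closedI; first exact: clA.
    apply: (@preimage_closed _ _ (fun a : 'cV[R]_d => `|a|) [set t | t <= B]).
      by move=> a _; exact: norm_continuous.
    exact: closed_le.
  apply: (@preimage_closed _ _ (fun a : 'cV[R]_d => `|astar s - a|) [set t | e <= t]).
    move=> a _; apply: continuous_comp; last exact: norm_continuous.
    by apply: continuousB; [exact: cst_continuous | exact: cvg_id].
  exact: closed_ge.
have bK a : K a -> `|a| <= B by case => -[].
have cK : compact K := bounded_closed_compact_cV clK bK.
have : \forall s' \near s, K `<=` [set a | Q (s', a) < Q (s', astar s)].
  apply: ((compact_near_coveringP K).1 cK _ (nbhs s)
    (fun s' a => Q (s', a) < Q (s', astar s) : Prop)) => a [[Aa _] ea].
  have [Aas aMax] := aA s Ss.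
  have Qa : Q (s, a) < Q (s, astar s).
    rewrite lt_neqAle aMax// andbT; apply/eqP => Qeq.
    have : argmax A (fun a => Q (s, a)) a by split=> // b /aMax; rewrite Qeq.
    rewrite aP// => /= aE; move: ea; rewrite /= aE subrr normr0.
    by rewrite leNgt e0.
  (* A level strictly between the two values separates them on whole neighbourhoods. *)
  pose m := (Q (s, a) + Q (s, astar s)) / 2.
  have Qam : Q (s, a) < m by rewrite /m; lra.
  have mQ : m < Q (s, astar s) by rewrite /m; lra.
  have H1 : \forall z \near (s, a), Q z < m.
    exact: (cvgr_lt (Q (s, a)) (cQ a Aa)).
  have H2 : \forall z \near (s, astar s), m < Q z.
    exact: (cvgr_gt (Q (s, astar s)) (cQ _ Aas)).
  have H3 : \forall s' \near s, m < Q (s', astar s).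
    have [[P1 P2] /= [sP1 aP2] sub] := H2.
    apply: filterS sP1 => s' P1s'; apply: (sub (s', astar s)); split=> //=.
    exact: nbhs_singleton aP2.
  have [[P1 P2] /= [sP1 aP2] sub] := H1.
  exists (P2, P1 `&` [set s' | m < Q (s', astar s)]) => /=.
    by split=> //; exact: filterI sP1 H3.
  move=> [a' s'] /= [P2a' [P1s' ms']].
  by apply: lt_trans ms'; exact: (sub (s', a')).
apply: filterS => s' Ks' Ss' hB; rewrite ltNge; apply/negP => ea.
have [Aas' aMax'] := aA s' Ss'.
have [Aas _] := aA s Ss.
have /Ks' : K (astar s') by split=> //; split=> //; exact: le_trans (norm_le_enorm _) hB.
by rewrite /= ltNge aMax'.
Qed.

Lemma action_gradient_estimate (R : realType) (k d : nat)
    (Q : 'cV[R]_k * 'cV[R]_d -> R) s a e :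
  (forall i, differentiable ('D_(dir_a R k i) Q) (s, a)) -> 0 < e ->
  \forall z \near (s, a),
    enorm (action_gradient Q z - action_gradient Q (s, a)
           - (hess_sa Q s a *m (z.1 - s) + hess_aa Q s a *m (z.2 - a)))
    <= e * (enorm (z.1 - s) + enorm (z.2 - a)).
Proof.
(* The factor [sqrt d] is the cost of passing from the maximum norm to the Euclidean one; adding [1]
   keeps [c] positive when [d = 0]. *)
move=> dG e0; pose c : R := Num.sqrt d%:R + 1.
have c0 : 0 < c by rewrite ltr_wpDl ?sqrtr_ge0.
have ec0 : 0 < e / c by rewrite divr_gt0.
pose near_linear i := [set z | `|'D_(dir_a R k i) Q z - 'D_(dir_a R k i) Q (s, a)
    - 'D_(z - (s, a)) ('D_(dir_a R k i) Q) (s, a)| <= e / c * `|z - (s, a)|].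
have FF : Filter (nbhs (s, a)) by exact: nbhs_filter.
have : \forall z \near (s, a), forall i, near_linear i z.
  exact: (@filter_forall _ _ near_linear (nbhs (s, a)) FF
    (fun i => differentiable_estimate (dG i) ec0)).
apply: filterS => z Hz.
set y := z.1 - s; set x := z.2 - a; set g := (X in enorm X).
have zE : z - (s, a) = (y, x) by rewrite [LHS]surjective_pairing.
have normz : `|z - (s, a)| <= enorm y + enorm x.
  rewrite zE prod_normE/= ge_max; apply/andP; split.
    by rewrite (le_trans (norm_le_enorm _))// lerDl enorm_ge0.
  by rewrite (le_trans (norm_le_enorm _))// lerDr enorm_ge0.
have gi i : `|g i 0| <= e / c * (enorm y + enorm x).
  have -> : g i 0 = 'D_(dir_a R k i) Q z - 'D_(dir_a R k i) Q (s, a)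
      - 'D_(z - (s, a)) ('D_(dir_a R k i) Q) (s, a).
    by rewrite zE derive_hess// /g !mxE.
  by apply: le_trans (Hz i) _; rewrite ler_wpM2l// ltW.
have yx0 : 0 <= enorm y + enorm x by rewrite addr_ge0 ?enorm_ge0.
have ng : `|g| <= e / c * (enorm y + enorm x).
  rewrite {1}/Num.norm/= mx_normrE; apply: bigmax_le.
    by rewrite mulr_ge0// ltW.
  by move=> [i j] _ /=; rewrite ord1.
apply: le_trans (enorm_le_norm _) _.
apply: (@le_trans _ _ (c * (e / c * (enorm y + enorm x)))).
  by rewrite ler_pM ?sqrtr_ge0// lerDl.
by rewrite mulrA mulrCA mulfV ?mulr1// gt_eqF.
Qed.

(** As both gradients vanish, [A y + H x] is only the remainder of the expansion. Pairing it with
    [x] gives [mu |x|^2 <= - dot x (H x) <= M |x| |y| + e |x| (|y| + |x|)], and [|x|] cancels. *)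
Lemma critical_point_estimate (R : realType) (k d : nat)
    (Q : 'cV[R]_k * 'cV[R]_d -> R) s a (M mu e : R) :
  (forall i, differentiable ('D_(dir_a R k i) Q) (s, a)) ->
  (hess_aa Q s a)^T = hess_aa Q s a ->
  spectral_norm (hess_sa Q s a) <= M -> lambda_max (hess_aa Q s a) <= - mu ->
  action_gradient Q (s, a) = 0 -> 0 < e ->
  \forall z \near (s, a), action_gradient Q z = 0 ->
    mu * enorm (z.2 - a) <= M * enorm (z.1 - s) + e * (enorm (z.1 - s) + enorm (z.2 - a)).
Proof.
move=> dG Hsym AM Hmu g0 e0.
apply: filterS (action_gradient_estimate dG e0) => z + gz.
rewrite gz g0 subrr sub0r enormN.
set A := hess_sa Q s a in AM *; set H := hess_aa Q s a in Hsym Hmu *.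
set y := z.1 - s; set x := z.2 - a => Hr.
have y0 := enorm_ge0 y; have x0 := enorm_ge0 x.
have Ay : enorm (A *m y) <= M * enorm y.
  by apply: le_trans (enorm_mulmx_le _ _) _; rewrite ler_wpM2r.
have Hx : dot x (H *m x) <= - mu * enorm x ^+ 2.
  by apply: le_trans (dot_le_lambda_max _ Hsym) _; rewrite ler_wpM2r// sqr_ge0.
(* Here there is nothing to cancel; the right side is nonnegative because [M |y|] dominates
   [|A y|]. *)
have [xE0|xN0] := eqVneq (enorm x) 0.
  rewrite xE0 mulr0 addr0 addr_ge0//; last by rewrite mulr_ge0// ltW.
  exact: le_trans (enorm_ge0 _) Ay.
have xgt0 : 0 < enorm x by rewrite lt_def xN0.
rewrite -(ler_pM2r xgt0).
have xA : dot x (A *m y) <= enorm x * (M * enorm y).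
  by apply: le_trans (dot_le_enorm _ _) _; rewrite ler_wpM2l.
have xr : - dot x (A *m y + H *m x) <= enorm x * (e * (enorm y + enorm x)).
  rewrite -mulN1r -dotZr scaleN1r; apply: le_trans (dot_le_enorm _ _) _.
  by rewrite enormN ler_wpM2l.
rewrite dotDr in xr; nra.
Qed.

Lemma hess_aa_sym (R : realType) (k d : nat) (Q : 'cV[R]_k * 'cV[R]_d -> R) U s a :
  open U -> C2_on U Q -> U (s, a) -> (hess_aa Q s a)^T = hess_aa Q s a.
Proof.
by move=> oU Q2 Usa; apply/matrixP => i j; rewrite !mxE (derive2C _ _ oU Q2 Usa).
Qed.

Lemma action_gradient_eq0 (R : realType) (k d : nat)
    (Q : 'cV[R]_k * 'cV[R]_d -> R) (A : set 'cV[R]_d) s a :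
  (\forall z \near (s, a), differentiable Q z) -> A^° a ->
  (forall b, A b -> Q (s, b) <= Q (s, a)) -> action_gradient Q (s, a) = 0.
Proof.
move=> dQ Aa aMax; apply/colP => i; rewrite !mxE.
apply: derive_eq0_at_local_max => //.
have : (fun t : R => a + t *: delta_mx i 0) @ (0 : R) --> a.
  rewrite -[X in _ --> X]addr0 -(scale0r (delta_mx i 0)).
  by apply: cvgD; [exact: cvg_cst | apply: cvgZr_tmp; exact: cvg_id].
move=> /(_ _ Aa) At.
have {}At : \forall t \near (0 : R), A (a + t *: delta_mx i 0) by exact: At.
apply: filterS At => t /aMax.
have -> // : (s, a) + t *: dir_a R k i = (s, a + t *: delta_mx i 0).
by rewrite [LHS]surjective_pairing/= scaler0 addr0.
Qed.

Lemma argmax_local_lipschitz (R : realType) (k d : nat)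
    (S : set 'cV[R]_k) (A : set 'cV[R]_d) (Q : 'cV[R]_k * 'cV[R]_d -> R)
    (U : set ('cV[R]_k * 'cV[R]_d)) (astar : 'cV[R]_k -> 'cV[R]_d) (M mu : R) s B e :
  closed A -> open U -> S `*` A `<=` U -> C2_on U Q ->
  (forall s, S s -> argmax A (fun a => Q (s, a)) = [set astar s]) ->
  (forall s, S s -> interior A (astar s)) ->
  0 < mu -> S s ->
  spectral_norm (hess_sa Q s (astar s)) <= M ->
  lambda_max (hess_aa Q s (astar s)) <= - mu ->
  0 < e ->
  \forall s' \near s, S s' -> enorm (astar s') <= B ->
    enorm (astar s - astar s') <= (M / mu + e) * enorm (s - s').
Proof.
move=> clA oU SAU Q2 aP aint mu0 Ss AM Hmu e0.
have M0 : 0 <= M := le_trans (spectral_norm_ge0 _) AM.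
have aA s' : S s' -> A (astar s') /\ forall b, A b -> Q (s', b) <= Q (s', astar s').
  by move=> /aP/seteqP[_ /(_ _ erefl)].
have Ua s' b : S s' -> A b -> U (s', b) by move=> Ss' Ab; apply: SAU.
have dQ z : U z -> differentiable Q z by case: Q2 => + _ => /[apply] -[].
have gradE s' : S s' -> action_gradient Q (s', astar s') = 0.
  move=> Ss'; have [Aa aMax] := aA s' Ss'.
  apply: action_gradient_eq0 (aint _ Ss') aMax.
  have : nbhs (s', astar s') U by apply: open_nbhs_nbhs; split=> //; exact: Ua.
  by apply: filterS => z /dQ.
have [Aa _] := aA s Ss; have Usa := Ua s _ Ss Aa.
have dG i : differentiable ('D_(dir_a R k i) Q) (s, astar s).
  by case: Q2 => _ /(_ (dir_a R k i) _ Usa)[].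
pose c := M / mu + e.
have c0 : 0 < c by rewrite ltr_wpDl// divr_ge0// ltW.
(* Chosen so that [M + e1 = (mu - e1) * c]: absorbing the [e1 |x|] term on the left then gives
   exactly the constant [c]. Moreover [e1 < mu], since [e <= c]. *)
pose e1 := mu * e / (1 + c).
have e10 : 0 < e1 by rewrite divr_gt0 ?mulr_gt0//; lra.
have := critical_point_estimate dG (hess_aa_sym oU Q2 Usa) AM Hmu (gradE s Ss) e10.
move=> /nbhs_ballP[r /= r0 Hr].
have cQ a : A a -> {for (s, a), continuous Q}.
  by move=> Ab; apply: differentiable_continuous; apply: dQ; exact: Ua.
have near_s : \forall s' \near s, ball s r s' by exact: nbhsx_ballx.
apply: filterS2 near_s (argmax_nearby B clA cQ aP Ss r0) => s' ss' aa' Ss' hB.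
have := Hr (s', astar s') _ (gradE s' Ss') => /=.
have {}aa' := aa' Ss' hB.
have -> : s' - s = - (s - s') by rewrite opprB.
have -> : astar s' - astar s = - (astar s - astar s') by rewrite opprB.
rewrite !enormN.
set x := enorm _ ; set y := enorm _ => H.
have {}H : mu * x <= M * y + e1 * (y + x).
  by apply: H; split=> //=; rewrite -ball_normE.
have y0 : 0 <= y := enorm_ge0 _.
have e1E : e1 * (1 + c) = mu * e by rewrite /e1 divfK// gt_eqF//; lra.
have cE : mu * c = M + mu * e by rewrite /c mulrDr mulrCA mulfV ?mulr1// gt_eqF.
have e1mu : e1 < mu.
  have ec : e <= c by rewrite lerDr divr_ge0// ltW.
  rewrite ltr_pdivrMr; last lra.
  by rewrite ltr_pM2l//; lra.
have : (mu - e1) * x <= (mu - e1) * (c * y).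
  have -> : (mu - e1) * (c * y) = (M + e1) * y.
    by rewrite mulrA; congr (_ * y); lra.
  lra.
by rewrite ler_pM2l// subr_gt0.
Qed.

(** * Restriction to segments and conclusion *)

Lemma convex_set_segment (R : realType) n (S : set 'cV[R]_n) s s' (t : R) :
  convex_set S -> S s -> S s' -> 0 <= t <= 1 -> S (s + t *: (s' - s)).
Proof.
move=> cS Ss Ss' /andP[t0 t1].
have := cS s' s (Itv01 t0 t1); rewrite !inE => /(_ Ss' Ss).
congr S; rewrite /conv/= /convex.conv/=.
by rewrite /unstable.onem scalerBl scale1r scalerBr addrCA.
Qed.

(** Extends a segment parametrized by [[0, 1]] to a curve on the whole line, constant outside, as
    the lemmas on the real line require. *)
Definition clamp01 (R : realType) (t : R) : R := Num.max 0 (Num.min 1 t).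

Lemma clamp01_itv (R : realType) (t : R) : 0 <= clamp01 t <= 1.
Proof. by rewrite /clamp01 le_max lexx/= ge_max ler01 ge_min lexx. Qed.

Lemma clamp01_lipschitz (R : realType) (t u : R) : `|clamp01 t - clamp01 u| <= `|t - u|.
Proof.
have := ler_norm (t - u); have := ler_norm (- (t - u)); rewrite normrN.
by rewrite ler_norml /clamp01 !maxEle !minEle; do 4?case: ifP; lra.
Qed.

Theorem proposition4p3 (R : realType) (k d : nat)
    (S : set 'cV[R]_k) (A : set 'cV[R]_d)
    (S_convex : convex_set S) (A_closed : closed A)
    (Q : 'cV[R]_k * 'cV[R]_d -> R)
    (U : set ('cV[R]_k * 'cV[R]_d))
    (U_open : open U) (SA_sub_U : S `*` A `<=` U) (Q_C2 : C2_on U Q)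
    (astar : 'cV[R]_k -> 'cV[R]_d)
    (astar_argmax : forall s, S s ->
      argmax A (fun a => Q (s, a)) = [set astar s])
    (astar_strict : forall s, S s ->
      strict_local_max (fun a => Q (s, a)) (astar s))
    (astar_interior : forall s, S s -> interior A (astar s))
    (M mu : R) (mu_gt0 : 0 < mu)
    (mixed_bound : forall s, S s -> spectral_norm (hess_sa Q s (astar s)) <= M)
    (action_concave : forall s, S s ->
      lambda_max (hess_aa Q s (astar s)) <= - mu) :
  exists L : R, L <= M / mu /\ lipschitz2_on L S astar.
Proof.
exists (M / mu); split=> // s s' Ss Ss'.
have M0 : 0 <= M := le_trans (spectral_norm_ge0 _) (mixed_bound s Ss).
pose N := enorm (s - s'); have N0 : 0 <= N := enorm_ge0 _.
apply/ler_addgt0Pr => e e0.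
(* This slack in the Lipschitz constant costs [e1 * N <= e] over the segment, including when
   [N = 0]. *)
pose e1 := e / (N + 1); have e10 : 0 < e1 by rewrite divr_gt0//; lra.
pose gamma t := s + clamp01 t *: (s' - s).
have Sgamma t : S (gamma t).
  exact: convex_set_segment S_convex Ss Ss' (clamp01_itv t).
have gamma_lip t u : enorm (gamma t - gamma u) <= `|t - u| * N.
  have -> : gamma t - gamma u = (clamp01 u - clamp01 t) *: (s - s').
    by rewrite /gamma opprD addrACA subrr add0r -scalerBl -(opprB s) scalerN -scaleNr opprB.
  by rewrite enormZ distrC ler_wpM2r// clamp01_lipschitz.
pose rho t u := enorm (astar (gamma t) - astar (gamma u)).
pose C := (M / mu + e1) * N.
have C10 : 0 <= M / mu + e1 by apply: addr_ge0 (ltW e10); rewrite divr_ge0 ?(ltW mu_gt0).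
have rhoP : pseudometric_on_line rho (fun t => enorm (astar (gamma t))).
  split=> [t u|t u v|t u]; rewrite /rho.
  - by rewrite -enormN opprB.
  - apply: le_trans (enormD _ _); rewrite le_eqVlt; apply/predU1P; left.
    by rewrite addrA subrK.
  - apply: le_trans (enormD _ _); rewrite le_eqVlt; apply/predU1P; left.
    by rewrite addrC subrK.
have rhoC : lipschitz_where_bounded rho (fun t => enorm (astar (gamma t))) C.
  move=> t B.
  have := argmax_local_lipschitz B A_closed U_open SA_sub_U Q_C2 astar_argmax
    astar_interior mu_gt0 (Sgamma t) (mixed_bound _ (Sgamma t))
    (action_concave _ (Sgamma t)) e10.
  move=> /nbhs_ballP[r /= r0 Hr].
  (* Since [gamma] is [N]-Lipschitz, parameters this close have images within [r]. *)
  apply/nbhs_ballP; exists (r / (N + 1)) => /=; first by rewrite divr_gt0//; lra.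
  move=> u; rewrite -ball_normE/= ltr_pdivlMr; last lra.
  move=> tu hB; have /Hr : ball (gamma t) r (gamma u).
    rewrite -ball_normE/=; apply: le_lt_trans (norm_le_enorm _) _.
    apply: le_lt_trans (gamma_lip t u) _; apply: le_lt_trans tu.
    by rewrite ler_wpM2l// lerDl.
  move=> /(_ (Sgamma u) hB) /le_trans; apply.
  by rewrite /C -mulrA ler_wpM2l// mulrC gamma_lip.
have := lipschitz_of_lipschitz_where_bounded (mulr_ge0 C10 N0) rhoP rhoC ler01.
have -> : rho 0 1 = enorm (astar s - astar s').
  rewrite /rho /gamma /clamp01 [Num.min 1 0]min_r// minxx maxxx [Num.max 0 1]max_r//.
  by rewrite scale0r addr0 scale1r [s + _]addrC subrK.
move=> /le_trans; apply; rewrite subr0 mulr1 /C mulrDl lerD2l.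
by rewrite /e1 mulrAC ler_pdivrMr ?ler_wpM2l ?(ltW e0)//; lra.
Qed.
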